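(* Let $G$ be a group of infinite order $\kappa$. Then $G$ has a set of $\kappa$ mutually orthogonal orthomorphisms, and hence there is a set of $\kappa$ mutually orthogonal Latin squares of order $\kappa$ (namely the squares $L_\theta(g,h)=g\,\theta(h)$, $g,h\in G$, for $\theta$ in this set).
   Context: For a group $G$, a bijection $\theta:G\to G$ is an orthomorphism if $g\mapsto g^{-1}\theta(g)$ is a bijection of $G$. Two orthomorphisms $\theta,\phi$ are orthogonal if $g\mapsto\theta(g)^{-1}\phi(g)$ is a bijection of $G$; a set of them is mutually orthogonal if any two distinct members are orthogonal. Two Latin squares $L_1,L_2:G\times G\to G$ (each row and column map a bijection) are orthogonal if for every $(x_1,x_2)\in G\times G$ there is exactly one $(g,h)$ with $L_1(g,h)=x_1$ and $L_2(g,h)=x_2$. *)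

(* Defs.v *)
From mathcomp Require Import all_boot.
From mathcomp Require Import boolp classical_sets functions cardinality.

Set Implicit Arguments.
Unset Strict Implicit.
Unset Printing Implicit Defensive.

Local Open Scope group_scope.

Definition mutually (T : Type) (r : T -> T -> Prop) (S : set T) : Prop :=
  forall x y : T, S x -> S y -> x <> y -> r x y.

Definition orthomorphism (G : groupType) (theta : G -> G) : Prop :=
  bijective theta /\ bijective (fun g : G => g^-1 * theta g).

Definition orthogonal_orthomorphisms (G : groupType) (theta phi : G -> G) : Prop :=
  bijective (fun g : G => (theta g)^-1 * phi g).

(* [L (g, h)] is the entry in row [g] and column [h]; the order of the square
   is the cardinality of [T]. *)
Definition latin_square (T : Type) (L : T * T -> T) : Prop :=
  (forall g : T, bijective (fun h : T => L (g, h))) /\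
  (forall h : T, bijective (fun g : T => L (g, h))).

Definition orthogonal_squares (T : Type) (L1 L2 : T * T -> T) : Prop :=
  forall x1 x2 : T, exists! gh : T * T, L1 gh = x1 /\ L2 gh = x2.

Definition square_of (G : groupType) (theta : G -> G) : G * G -> G :=
  fun gh => gh.1 * theta gh.2.

(* Main.v *)
(* It suffices to find maps [f_ i : G -> G], one for each [i] in [G], such that
   [x |-> (f_ i x)^-1 * f_ j x] is bijective whenever [i <> j]: for fixed
   [u <> v], multiplying all [f_ i] on the left by [f_ u ^-1] and
   reparametrizing so that [f_ u] becomes the constant [1] and [f_ v] the
   identity turns the remaining [f_ i] into mutually orthogonal orthomorphisms.
   Such a family is built by transfinite recursion of length [#|G|]. As long as
   fewer than [#|G|] values have been prescribed, any further value [f_ i x] can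
   be chosen without destroying injectivity, since fewer than [#|G|] choices are
   excluded; and any [h] can be made a value of [(f_ i)^-1 * f_ j], by means of
   an [x] at which nothing has been prescribed yet. There are only [#|G|]
   requirements because an infinite cardinal equals its square. *)
Require Import Defs.
From mathcomp Require Import all_boot.
From mathcomp Require Import boolp classical_sets functions cardinality.
From mathcomp Require Import wochoice.

Set Implicit Arguments.
Unset Strict Implicit.
Unset Printing Implicit Defensive.

Local Open Scope classical_set_scope.
Local Open Scope card_scope.

(** * Cardinal arithmetic *)

(** Any choice function for [R] is injective on [A]; the relational form lets later proofs supply
    only the graph of an injection. *)
Lemma card_le_rel T U (A : set T) (B : set U) (R : T -> U -> Prop) :
  (forall a, A a -> exists2 b, B b & R a b) ->
  (forall a a' b, A a -> A a' -> R a b -> R a' b -> a = a') ->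
  A #<= B.
Proof.
move=> Rtot Rinj.
have /choice[f fR] (a : A) : exists b : B, R (val a) (val b).
  have [b Bb Rab] := Rtot _ (set_mem (valP a)).
  by exists (SigSub (mem_set Bb)).
apply/card_leP/injfunPex; exists f => // a a' _ _ faa'; apply: val_inj.
apply: (Rinj _ _ (val (f a))) => //; try exact/set_mem/valP.
by rewrite faa'.
Qed.

Lemma card_le_inj T U (A : set T) (B : set U) (f : T -> U) :
  (forall a, A a -> B (f a)) ->
  (forall a a', A a -> A a' -> f a = f a' -> a = a') -> A #<= B.
Proof.
move=> fAB finj; apply: (card_le_rel (R := fun a b => f a = b)).
  by move=> a Aa; exists (f a) => //; exact: fAB.
by move=> a a' b Aa Aa' <- /esym /finj; exact.
Qed.

Lemma card_le_ex T (U : pointedType) (A : set T) (B : set U) :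
  A #<= B -> exists f : T -> U, (forall a, A a -> B (f a)) /\
    (forall a a', A a -> A a' -> f a = f a' -> a = a').
Proof.
move=> /pcard_leP[f]; exists f; split=> [a Aa|a a' Aa Aa' faa'].
  exact: (@funS _ _ _ _ f).
by apply: (@inj _ _ _ f); [exact: mem_set|exact: mem_set|].
Qed.

Lemma card_leTP T U (B : set U) :
  [set: T] #<= B -> exists2 f : T -> U, injective f & forall t, B (f t).
Proof.
move=> /card_leP[f]; pose s t : [set: T] := SigSub (mem_set (I : [set: T] t)).
exists (fun t => val (f (s t))).
  move=> t t' /val_inj/(@inj _ _ _ f) tt'.
  by have /(congr1 val) := tt' (mem_set I) (mem_set I).
by move=> t; exact/set_mem/valP.
Qed.

Lemma card_leX T T' U U' (A : set T) (B : set U) (A' : set T') (B' : set U') :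
  A #<= B -> A' #<= B' -> A `*` A' #<= B `*` B'.
Proof.
move=> /card_leP[f] /card_leP[g].
apply: (card_le_rel (R := fun p q =>
  exists (a : A) (a' : A'), p = (val a, val a') /\ q = (val (f a), val (g a')))).
  move=> [a a'] [/= Aa Aa'].
  exists (val (f (SigSub (mem_set Aa))), val (g (SigSub (mem_set Aa')))).
    by split; exact/set_mem/valP.
  by exists (SigSub (mem_set Aa)), (SigSub (mem_set Aa')).
move=> p p' q _ _ [a [a' [-> ->]]] [b [b' [-> [/val_inj ab /val_inj ab']]]].
by rewrite (@inj _ _ _ f a b) ?inE// (@inj _ _ _ g a' b') ?inE.
Qed.

Lemma total_on_subset2 T (F : set (set T)) (X Y : set T) :
  total_on F subset -> F X -> F Y -> exists Z, [/\ F Z, X `<=` Z & Y `<=` Z].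
Proof.
move=> Ftot FX FY.
by have [XY|YX] := Ftot _ _ FX FY; [exists Y|exists X]; split => // ?.
Qed.

Lemma card_le_total T U (A : set T) (B : set U) : A #<= B \/ B #<= A.
Proof.
pose P (F : set (T * U)) := F `<=` A `*` B /\
  forall p q, F p -> F q -> p.1 = q.1 <-> p.2 = q.2.
have [|F [[FAB Finj] Fmax]] := @Zorn_bigcup _ P.
  move=> C CP Ctot; split=> [p [X CX Xp]|p q [X CX Xp] [Y CY Yq]].
    by have [XAB _] := CP _ CX; exact: XAB.
  have [Z [CZ XZ YZ]] := total_on_subset2 Ctot CX CY.
  by have [_] := CP _ CZ; apply; [exact: XZ|exact: YZ].
have [Ftot|/existsNP[a /not_implyP[Aa Fa]]] :=
    pselect (forall a, A a -> exists b, F (a, b)).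
  left; apply: (card_le_rel (R := fun a b => F (a, b))) => [a Aa|a a' b _ _].
    by have [b Fab] := Ftot _ Aa; exists b => //; have [] := FAB _ Fab.
  by move=> Fab /(Finj _ _ Fab)/= [_]; exact.
have [Fsurj|/existsNP[b /not_implyP[Bb Fb]]] :=
    pselect (forall b, B b -> exists a, F (a, b)).
  right; apply: (card_le_rel (R := fun b a => F (a, b))) => [b Bb|b b' a' _ _].
    by have [a' Fab] := Fsurj _ Bb; exists a' => //; have [] := FAB _ Fab.
  by move=> Fab /(Finj _ _ Fab)/= [+ _]; exact.
have /Fmax[] : F `<` F `|` [set (a, b)].
  split=> [|/(_ (a, b))]; first by move=> ? ?; left.
  by move=> FFab; apply: Fa; exists b; apply: FFab; right.
split=> [p [/FAB|->]|[a1 b1] [a2 b2] /=]; [by []|by split|].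
case=> [F1|[-> ->]] [F2|[-> ->]]; last by [].
- exact: (Finj _ _ F1 F2).
- by split=> eq1; [case: Fa|case: Fb]; [exists b1|exists a1]; rewrite -eq1.
- by split=> eq2; [case: Fa|case: Fb]; [exists b2|exists a2]; rewrite eq2.
Qed.

(** Zorn's lemma is applied to the sets whose union with [F0] satisfies [P]; the hypothesis [P F0]
    settles the empty chain. *)
Lemma Zorn_bigcup_above T (P : set (set T)) (F0 : set T) :
  P F0 ->
  (forall C : set (set T), C !=set0 -> C `<=` P -> total_on C subset ->
     P (\bigcup_(X in C) X)) ->
  exists F, [/\ P F, F0 `<=` F & forall B, F `<` B -> ~ P B].
Proof.
move=> PF0 Pcup; have [|F [PF Fmax]] := @Zorn_bigcup _ (fun X => P (F0 `|` X)).
  move=> C CP Ctot; have [->|C0] := eqVneq C set0.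
    by rewrite bigcup_set0 setU0.
  have [X0 CX0] : C !=set0 by exact/set0P.
  suff -> : F0 `|` \bigcup_(X in C) X =
      \bigcup_(Y in [set F0 `|` X | X in C]) Y.
    apply: Pcup; first by exists (F0 `|` X0), X0.
      by move=> _ [X CX <-]; exact: CP.
    move=> _ _ [X CX <-] [Y CY <-].
    by have [XY|YX] := Ctot _ _ CX CY; [left|right]; exact: setUS.
  apply/seteqP; split=> [x [F0x|[X CX Xx]]|x [_ [X CX <-] [F0x|Xx]]].
  - by exists (F0 `|` X0); [exists X0|left].
  - by exists (F0 `|` X); [exists X|right].
  - by left.
  - by right; exists X.
exists (F0 `|` F); split=> // B [FB BF] PB.
apply: (Fmax B); first split.
- by move=> x Fx; apply: FB; right.
- by move=> BsF; apply: BF => x /BsF; right.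
- suff -> : F0 `|` B = B by [].
  by apply/setUidPr => x F0x; apply: FB; left.
Qed.

Lemma card_leU (T U : pointedType) (X Y : set T) (D : set U) (d0 d1 : U) :
  D d0 -> D d1 -> d0 <> d1 -> D `*` D #<= D ->
  X #<= D -> Y #<= D -> X `|` Y #<= D.
Proof.
move=> Dd0 Dd1 d01 DD /card_le_ex[f [fD finj]] /card_le_ex[g [gD ginj]].
apply: card_le_trans DD.
have YX x : (X `|` Y) x -> ~ X x -> Y x by case.
(* The tags [d0] and [d1] separate the images of the two sets inside the square of [D]; common
   elements get [d0]. *)
pose h x := if pselect (X x) then (d0, f x) else (d1, g x).
apply: (card_le_inj (f := h)) => [x XYx|x y XYx XYy].
  rewrite /h; case: pselect => Xx; split => //=; first exact: fD.
  by apply: gD; exact: YX.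
rewrite /h; case: pselect => Xx; case: pselect => Xy // [].
- exact: finj.
- by move/d01.
- by move/esym/d01.
- by apply: ginj; exact: YX.
Qed.

(* Zorn's lemma is applied to the graphs of injections [D `*` D -> D] with
   [D `<=` A], starting from a countable [D]; the domain [D] of such a graph is
   read off its diagonal. If a maximal [D] were too small, [A] would contain a
   disjoint copy [E] of [D], and the injection would extend to [D `|` E] by
   sending the new pairs into [E]. *)
Theorem card_le_setX_infinite T (A : set T) : infinite_set A -> A `*` A #<= A.
Proof.
elim/Ppointed: T A => T A; first by rewrite emptyE => /(_ (finite_set0 _)).
move=> /infiniteP/card_leTP[n ninj nA].
pose dom (F : set (T * T * T)) x := exists z, F (x, x, z).
(* The last clause says at once that [F] is single-valued and injective; the first keeps its values
   inside its own domain. *)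
pose P (F : set (T * T * T)) := [/\ forall x y z, F (x, y, z) ->
    [/\ dom F x, dom F y & dom F z], dom F `<=` A,
  forall x y, dom F x -> dom F y -> exists z, F (x, y, z) &
  forall p q, F p -> F q -> p.1 = q.1 <-> p.2 = q.2].
pose F0 := [set q : T * T * T |
  exists i j, q = (n i, n j, n (pickle (i, j)))].
have F0n i : dom F0 (n i) by exists (n (pickle (i, i))), i, i.
have PF0 : P F0.
  split=> [x y z [i [j [-> -> ->]]]|x [z [i [j [-> _ _]]]]||] //.
    move=> x y [_ [i [_ [-> _ _]]]] [_ [j [_ [-> _ _]]]].
    by exists (n (pickle (i, j))), i, j.
  move=> _ _ [i [j ->]] [k [l ->]] /=.
  split=> [[/ninj -> /ninj ->]//|/ninj/(pcan_inj pickleK)[-> ->]//].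
have [C [X0 CX0] CP Ctot|F [[Fdom FA Ftot Finj] F0F Fmax]] :=
    Zorn_bigcup_above PF0.
  have domC X : C X -> dom X `<=` dom (\bigcup_(X in C) X).
    by move=> CX x [z Xz]; exists z, X.
  split=> [x y z [X CX Xxyz]|x [z [X CX Xxz]]||].
  - have [/(_ x y z Xxyz)[? ? ?] _ _ _] := CP _ CX.
    by split; apply: domC CX _ _.
  - by have [_ + _ _] := CP _ CX; apply; exists z.
  - move=> x y [z [X CX Xxz]] [t [Y CY Yyt]].
    have [Z [CZ XZ YZ]] := total_on_subset2 Ctot CX CY.
    have [_ _ /(_ x y) Ztot _] := CP _ CZ.
    have [||u Zu] := Ztot; last by exists u, Z.
      by exists z; exact: XZ.
    by exists t; exact: YZ.
  - move=> p q [X CX Xp] [Y CY Yq].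
    have [Z [CZ XZ YZ]] := total_on_subset2 Ctot CX CY.
    by have [_ _ _] := CP _ CZ; apply; [exact: XZ|exact: YZ].
set D := dom F in Fdom FA Ftot.
have Dn i : D (n i) by have [z F0z] := F0n i; exists z; exact: F0F.
have n01 : n 0 <> n 1 by move/ninj.
have DD : D `*` D #<= D.
  apply: (card_le_rel (R := fun p z => F (p, z))) => [[x y] [/= Dx Dy]|].
    by have [z Fz] := Ftot _ _ Dx Dy; exists z => //; have [] := Fdom _ _ _ Fz.
  by move=> p q z _ _ Fp /(Finj _ _ Fp)/= [_]; exact.
have [AD|DA] := card_le_total (A `\` D) D.
  have {}AD : A #<= D.
    have /subset_card_le/card_le_trans : A `<=` D `|` A `\` D.
      by move=> x Ax; have [Dx|Dx] := pselect (D x); [left|right].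
    by apply; apply: (card_leU (d0 := n 0) (d1 := n 1)).
  apply: card_le_trans (card_leX AD AD) _; apply: card_le_trans DD _.
  exact: subset_card_le.
move: DA => /card_le_ex[e [eAD einj]].
pose E := e @` D.
have /card_le_ex[u [uD uinj]] : D `|` E #<= D.
  by apply: (card_leU (d0 := n 0) (d1 := n 1)) => //; exact: card_image_le.
have /card_le_ex[v [vD vinj]] := DD.
(* [u] squeezes [D] and [E] together into [D], [v] codes the resulting pair by one element of [D],
   and [e] moves it into [E], away from all values of [F]. *)
pose w x y := e (v (u x, u y)).
pose DE := D `|` E.
have DDu x y : DE x -> DE y -> (D `*` D) (u x, u y).
  by move=> DEx DEy; split; exact: uD.
have Dv x y : DE x -> DE y -> D (v (u x, u y)).
  by move=> DEx DEy; apply: vD; exact: DDu.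
have winj x y x' y' : DE x -> DE y -> DE x' -> DE y' ->
    w x y = w x' y' -> (x, y) = (x', y').
  move=> DEx DEy DEx' DEy' /(einj _ _ (Dv _ _ DEx DEy) (Dv _ _ DEx' DEy')).
  move=> /(vinj _ _ (DDu _ _ DEx DEy) (DDu _ _ DEx' DEy'))[xx' yy'].
  by rewrite (uinj _ _ DEx DEx' xx') (uinj _ _ DEy DEy' yy').
pose F' := F `|` [set q | [/\ DE q.1.1, DE q.1.2, ~ (D q.1.1 /\ D q.1.2) &
                             q.2 = w q.1.1 q.1.2]].
have Ew x y : DE x -> DE y -> E (w x y).
  by move=> DEx DEy; exists (v (u x, u y)) => //; exact: Dv.
have ED x : E x -> ~ D x by move=> [y Dy <-]; have [] := eAD _ Dy.
have DF' : dom F' = DE.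
  apply/seteqP; split=> [x [z [Fz|[]//]]|x [[z Fz]|Ex]].
  - by left; exists z.
  - by exists z; left.
  - by exists (w x x); right; split; [right|right|case=> /(ED _ Ex)|].
have /Fmax[] : F `<` F'.
  split=> [|F'F]; first exact: subsetUl.
  have En : E (e (n 0)) by exists (n 0).
  have [z /F'F Fz] : dom F' (e (n 0)) by rewrite DF'; right.
  by apply: (ED _ En); exists z.
split; rewrite ?DF'.
- move=> x y z [/Fdom[? ? ?]|[/= DEx DEy _ ->]]; first by split; left.
  by split => //; right; exact: Ew.
- by move=> x [/FA//|[y Dy <-]]; have [] := eAD _ Dy.
- move=> x y DEx DEy; have [[Dx Dy]|Dxy] := pselect (D x /\ D y).
    by have [z Fz] := Ftot _ _ Dx Dy; exists z; left.
  by exists (w x y); right.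
- move=> [[x y] z] [[x' y'] z'] /= [Fz|[/= DEx DEy Dxy ->]].
    have [Dx Dy Dz] := Fdom _ _ _ Fz.
    case=> [Fz'|[/= DEx' DEy' Dxy' ->]]; first exact: (Finj _ _ Fz Fz').
    split=> [[xx' yy']|zE]; first by rewrite -xx' -yy' in Dxy'; case: Dxy'.
    by have /ED[] := Ew _ _ DEx' DEy'; rewrite -zE.
  case=> [Fz'|[/= DEx' DEy' Dxy' ->]].
    have [Dx' Dy' Dz'] := Fdom _ _ _ Fz'.
    split=> [[xx' yy']|zE]; first by rewrite xx' yy' in Dxy; case: Dxy.
    by have /ED[] := Ew _ _ DEx DEy; rewrite zE.
  by split=> [[-> ->]//|/winj]; exact.
Qed.

Lemma card_le_setX K T (P : set T) :
  infinite_set [set: K] -> [set: K] #<= P `*` P -> [set: K] #<= P.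
Proof.
move=> Kinf KPP; have [Pfin|/card_le_setX_infinite] := pselect (finite_set P).
  by case: Kinf; apply: card_le_finite KPP _; exact: finite_setX.
exact: card_le_trans.
Qed.

(** Numbering each [F i] by naturals embeds the union into the product of [D] and [nat], which is no
    larger than [D] when [D] is infinite. *)
Lemma card_le_bigcup_finite K I T (D : set I) (F : I -> set T) :
  infinite_set [set: K] -> (forall i, D i -> finite_set (F i)) ->
  [set: K] #<= \bigcup_(i in D) F i -> [set: K] #<= D.
Proof.
move=> Kinf Ffin KF; have [Dfin|Dinf] := pselect (finite_set D).
  by case: Kinf; apply: card_le_finite KF _; exact: bigcup_finite.
apply: card_le_trans (card_le_setX_infinite Dinf).
apply: card_le_trans (card_leX (card_lexx D) ((infiniteP _).1 Dinf)).
apply: card_le_trans KF _.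
have /choice[g ginj] i : exists g : T -> nat, D i ->
    forall x y, F i x -> F i y -> g x = g y -> x = y.
  have [Di|Di] := pselect (D i); last by exists (fun=> 0).
  by have /finite_set_countable/card_le_ex[g [_ ginj]] := Ffin _ Di; exists g.
apply: (card_le_rel (R := fun x p => [/\ D p.1, F p.1 x & g p.1 x = p.2])).
  by move=> x [i Di Fix]; exists (i, g i x).
by move=> x y [i m] _ _ [/= Di Fix <-] [_ Fiy /esym]; exact: ginj.
Qed.

Lemma injective_pairing K :
  infinite_set [set: K] -> exists p : K * K -> K, injective p.
Proof.
move=> /card_le_setX_infinite; rewrite setXTT => /card_leTP[p pinj _].
by exists p.
Qed.

(** * Transfinite constructions *)

Lemma well_founded_minimal T (lt : T -> T -> Prop) (P : T -> Prop) :
  well_founded lt -> (exists t, P t) ->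
  exists t, P t /\ forall s, lt s t -> ~ P s.
Proof.
move=> ltwf [t0]; elim/(well_founded_ind ltwf): t0 => t IH Pt.
have [[s [st Ps]]|noP] := pselect (exists s, lt s t /\ P s); first exact: IH Ps.
by exists t; split=> // s st Ps; apply: noP; exists s.
Qed.

Definition strict_well_order T (lt : T -> T -> Prop) :=
  [/\ well_founded lt, forall r s t, lt r s -> lt s t -> lt r t &
      forall s t, s <> t -> lt s t \/ lt t s].

Lemma strict_well_order_exists T : exists lt : T -> T -> Prop, strict_well_order lt.
Proof.
elim/Peq: T => T; have [R Rwo] := well_ordering_principle T.
have Rmin (S : set T) : S !=set0 -> exists2 x, S x & forall y, S y -> R x y.
  move=> [x Sx]; have [|z [[Sz zmin] _]] := Rwo [pred x | `[< S x >]].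
    by exists x; exact/asboolP.
  by exists z => [|y Sy]; [exact/asboolP|apply: zmin; exact/asboolP].
have Rchain : wo_chain R predT by move=> A _; exact: Rwo.
have Ranti x y : R x y -> R y x -> x = y.
  by move=> xy yx; apply: (wo_chain_antisymmetric Rchain) => //; rewrite xy.
exists (fun x y => R x y /\ x <> y); split.
- move=> x; apply: contrapT => nacc.
  have [|z nz zmin] := Rmin [set y | ~ Acc (fun x y => R x y /\ x <> y) y].
    by exists x.
  apply: nz; constructor => y [yz neq]; apply: contrapT => ny.
  by apply: neq; apply: Ranti yz _; exact: zmin.
- move=> r s t [rs nrs] [st nst].
  have rt : r <> t by move=> rt; apply: nrs; apply: Ranti rs _; rewrite rt.
  split=> //; have [|z] := Rmin [set r; s; t]; first by exists r; left; left.
  move=> [[->|->]|->] zmin; first by apply: zmin; right.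
    by case: nrs; apply: Ranti rs _; apply: zmin; left; left.
  by case: nst; apply: Ranti st _; apply: zmin; left; right.
- move=> s t st; have /orP[Rst|Rts] : R s t || R t s by exact: wo_chainW Rchain _ _ _ _.
    by left.
  by right; split=> // /esym.
Qed.

(** Well-order [K]. If some proper initial segment is as large as [K], inject [K] into the one below
    the least such [k]: by minimality, all segments below its elements are small. The order is then
    pulled back to [T]. *)
Lemma small_segments_order K T (e : T -> K) : injective e ->
  exists lt : T -> T -> Prop, strict_well_order lt /\
    forall t, ~ ([set: K] #<= [set s | lt s t]).
Proof.
move=> einj; have [lt [ltwf lttr lttot]] := strict_well_order_exists K.
have [g ginj gsmall] : exists2 g : T -> K, injective g &
    forall t, ~ ([set: K] #<= [set k | lt k (g t)]).
  have [big|small] := pselect (exists k, [set: K] #<= [set l | lt l k]).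
    have [k [/card_leTP[f finj fk] kmin]] := well_founded_minimal ltwf big.
    by exists (f \o e) => [|t]; [exact: inj_comp|apply: kmin; exact: fk].
  by exists e => // t big; apply: small; exists (e t).
exists (fun s t => lt (g s) (g t)); split=> [|t Kt].
  split=> [|r s t|s t st]; last by apply: lttot => /ginj.
    move=> s; move: {2}(g s) (erefl (g s)) => k.
    elim/(well_founded_ind ltwf): k s => k IH s sk; constructor => r rs.
    by apply: (IH (g r)) => //; rewrite -sk.
  exact: lttr.
apply: (gsmall t); apply: card_le_trans Kt _.
by apply: (card_le_inj (f := g)) => // s s' _ _ /ginj.
Qed.

(* The requirements [r : I] are met one after the other, along a well-ordering
   all of whose proper initial segments are smaller than [K]; each step adds
   finitely many elements, so that what has been built remains smaller than
   [K] until the end. *)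
Lemma transfinite_construction K I T (e : I -> K) (valid : set (set T))
    (meets : I -> set T -> Prop) :
  infinite_set [set: K] -> injective e ->
  (forall F, F `<=` valid -> total_on F subset -> valid (\bigcup_(X in F) X)) ->
  (forall i X Y, X `<=` Y -> meets i X -> meets i Y) ->
  (forall i X, valid X -> ~ ([set: K] #<= X) ->
     exists Y, [/\ finite_set Y, valid (X `|` Y) & meets i (X `|` Y)]) ->
  exists X, valid X /\ forall i, meets i X.
Proof.
move=> Kinf einj vcup mmono ext.
have [lt [[ltwf lttr lttot] ltsmall]] := small_segments_order einj.
(* The empty set is a default for invalid or too large arguments, so that the recursion can be run
   before the stages are known to be valid and small. *)
have /choice[step stepP] (q : I * set T) : exists Y, valid q.2 ->
    ~ ([set: K] #<= q.2) ->
    [/\ finite_set Y, valid (q.2 `|` Y) & meets q.1 (q.2 `|` Y)].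
  have [vq|vq] := pselect (valid q.2); last by exists set0.
  have [Kq|Kq] := pselect ([set: K] #<= q.2); first by exists set0.
  by have [Y YP] := ext q.1 _ vq Kq; exists Y.
pose body i (rec : forall j, lt j i -> set T) :=
  step (i, [set x | exists j (ji : lt j i), rec j ji x]).
pose N := Fix ltwf (fun=> set T) body.
pose below i := \bigcup_(j in [set j | lt j i]) N j.
have NE i : N i = step (i, below i).
  rewrite /N Fix_eq => [|j f g fg]; rewrite /body; congr (step (_, _)).
    apply/seteqP; split=> [x [j [ji Nx]]|x [j ji Nx]]; first by exists j.
    by exists j, ji.
  by apply/seteqP; split=> x [k [kj Hx]]; exists k, kj; rewrite ?fg// -fg.
pose stage i := below i `|` N i.
have stage_mono j i : lt j i -> stage j `<=` below i.
  move=> ji x [[k kj Nx]|Nx]; last by exists j.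
  by exists k => //; exact: lttr kj ji.
have stage_chain (D : set I) : total_on [set stage i | i in D] subset.
  move=> _ _ [i _ <-] [j _ <-].
  have [->|/lttot[ij|ji]] := pselect (i = j); first by left.
    by left=> x /(stage_mono _ _ ij); left.
  by right=> x /(stage_mono _ _ ji); left.
have stageP i : [/\ finite_set (N i), valid (stage i) & meets i (stage i)].
  elim/(well_founded_ind ltwf): i => i IH.
  rewrite /stage NE; apply: (stepP (i, below i)) => /=.
    (* Validity is known for whole stages, not for the increments [N j], so [below i] is rewritten
       as the union of a chain of stages. *)
    suff -> : below i = \bigcup_(X in [set stage j | j in [set j | lt j i]]) X.
      by apply: vcup => // _ [j ji <-]; have [] := IH _ ji.
    apply/seteqP; split=> [x [j ji Nx]|x [_ [j ji <-] Xx]].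
      by exists (stage j); [exists j|right].
    exact: stage_mono ji _ Xx.
  move=> /(card_le_bigcup_finite Kinf) Ki; apply: (ltsmall i); apply: Ki.
  by move=> j ji; have [] := IH _ ji.
exists (\bigcup_(X in range stage) X); split.
  by apply: vcup => // _ [i _ <-]; have [] := stageP i.
move=> i; have [_ _] := stageP i; apply: mmono => x Xx.
by exists (stage i) => //; exists i.
Qed.

(** * Orthogonal families of maps into a group *)

Local Open Scope group_scope.

(* [P (x, i, v)] means that the partial map [f_ i] sends [x] to [v]. *)
Definition orthogonal_table (X I : Type) (G : groupType) (P : set (X * I * G)) :=
  (forall x i a b, P (x, i, a) -> P (x, i, b) -> a = b) /\
  (forall x y i j a b c d, i <> j -> P (x, i, a) -> P (x, j, b) ->
     P (y, i, c) -> P (y, j, d) -> a^-1 * b = c^-1 * d -> x = y).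

Section Tables.
Variables (X I : Type) (G : groupType).
Implicit Type P : set (X * I * G).

Lemma orthogonal_table_bigcup (F : set (set (X * I * G))) :
  F `<=` @orthogonal_table X I G -> total_on F subset ->
  orthogonal_table (\bigcup_(P in F) P).
Proof.
move=> Fvalid Ftot; split.
  move=> x i a b [P FP Pa] [Q FQ Qb].
  have [R [FR PR QR]] := total_on_subset2 Ftot FP FQ.
  have [Rfun _] := Fvalid _ FR.
  by apply: Rfun (PR _ Pa) (QR _ Qb).
move=> x y i j a b c d ij [P1 F1 Pa] [P2 F2 Pb] [P3 F3 Pc] [P4 F4 Pd].
have [Q [FQ P1Q P2Q]] := total_on_subset2 Ftot F1 F2.
have [R [FR P3R P4R]] := total_on_subset2 Ftot F3 F4.
have [S [FS QS RS]] := total_on_subset2 Ftot FQ FR.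
have [_ Sinj] := Fvalid _ FS.
apply: Sinj ij (QS _ (P1Q _ Pa)) (QS _ (P2Q _ Pb)) _ _.
  exact: RS _ (P3R _ Pc).
exact: RS _ (P4R _ Pd).
Qed.

(* Every [P] that is smaller than [G] excludes fewer than [G] values at [x],
   namely those of the form [b * d^-1 * c] below. *)
Lemma orthogonal_table_fill P x i :
  infinite_set [set: G] -> orthogonal_table P -> ~ ([set: G] #<= P) ->
  exists v, orthogonal_table (P `|` [set (x, i, v)]).
Proof.
move=> Ginf [Pfun Pinj] Psmall.
have [[v Pv]|nP] := pselect (exists v, P (x, i, v)).
  by exists v; rewrite (_ : _ `|` _ = P)//; apply/setUidPl => _ ->.
have [v vP] : exists v, forall j y b c d, P (x, j, b) -> P (y, i, c) ->
    P (y, j, d) -> v <> b * d^-1 * c.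
  apply: contrapT => /forallNP nv; apply: Psmall.
  (* A forbidden value is determined by three entries of [P]; one is repeated to form a pair of
     pairs, whence the two applications. *)
  apply: (card_le_setX Ginf); apply: (card_le_setX Ginf).
  apply: (card_le_rel (R := fun v q =>
      v = q.1.1.2 * q.1.2.2^-1 * q.2.1.2)) => [v _|v v' q _ _ -> ->//].
  apply: contrapT => nq; apply: (nv v) => j y b c d Pb Pc Pd vE.
  by apply: nq; exists ((x, j, b), (y, j, d), ((y, i, c), (y, i, c))).
exists v; have cellP y j a : (P `|` [set (x, i, v)]) (y, j, a) ->
    P (y, j, a) \/ [/\ y = x, j = i & a = v].
  by case=> [|[-> -> ->]]; [left|right].
split=> [y j a b /cellP[Pa|[yx ji ->]] /cellP[Pb|[yx' ji' ->]]//|].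
- exact: Pfun Pa Pb.
- by case: nP; exists a; rewrite -yx' -ji'.
- by case: nP; exists b; rewrite -yx -ji.
have vinj y j b c d : i <> j -> P (x, j, b) -> P (y, i, c) -> P (y, j, d) ->
    v^-1 * b = c^-1 * d -> False.
  move=> ij Pb Pc Pd vb; case: (vP j y b c d) => //.
  by rewrite -[b](mulVKg v) vb -!mulgA mulVKg mulVg mulg1.
have vinj' y j b c d : i <> j -> P (x, j, b) -> P (y, i, c) -> P (y, j, d) ->
    b^-1 * v = d^-1 * c -> False.
  move=> ij Pb Pc Pd bv; apply: (vinj y j b c d) => //.
  by apply: invg_inj; rewrite !invgM !invgK.
(* If two or more of the four entries are new, then [y = z] or [j = k]; the cases that survive have
   at most one new entry. *)
move=> y z j k a b c d jk.
move=> /cellP[Pa|[yx ji ->]] /cellP[Pb|[yx' ki ->]] /cellP[Pc|[zx ji' ->]]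
  /cellP[Pd|[zx' ki' ->]] E; subst; try by [].
- exact: Pinj jk Pa Pb Pc Pd E.
- by case: (vinj' y j c b a) => // /esym.
- by case: (vinj y k d a b).
- by case: (vinj' z j a d c) => // /esym.
- by case: (vinj z k b c d).
Qed.

Lemma orthogonal_table_hit P i j h :
  orthogonal_table P -> ~ ([set: X] #<= P) -> i <> j ->
  exists Y, [/\ finite_set Y, orthogonal_table (P `|` Y) &
    exists x a b, [/\ (P `|` Y) (x, i, a), (P `|` Y) (x, j, b) & a^-1 * b = h]].
Proof.
move=> [Pfun Pinj] Psmall ij.
have [hit|nohit] := pselect (exists x a b,
    [/\ P (x, i, a), P (x, j, b) & a^-1 * b = h]).
  by exists set0; rewrite setU0; split=> //; exact: finite_set0.
have [x Px] : exists x, forall k a, ~ P (x, k, a).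
  apply: contrapT => /forallNP nx; apply: Psmall.
  apply: (card_le_rel (R := fun x q => x = q.1.1)) => [x _|x x' q _ _ -> ->//].
  apply: contrapT => nq; apply: (nx x) => k a Pxka.
  by apply: nq; exists (x, k, a).
exists [set (x, i, 1); (x, j, h)]; split; first exact: finite_set2; last first.
  by exists x, 1, h; split; [right; left|right; right|rewrite invg1 mul1g].
have cellP y k a : (P `|` [set (x, i, 1); (x, j, h)]) (y, k, a) ->
    y <> x /\ P (y, k, a) \/ y = x /\ (k = i /\ a = 1 \/ k = j /\ a = h).
  case=> [Pa|[[-> -> ->]|[-> -> ->]]]; last 2 first.
  - by right; split=> //; left.
  - by right; split=> //; right.
  by left; split=> // yx; apply: (Px k a); rewrite -yx.
have xinj z k l a b c d : k <> l -> k = i /\ a = 1 \/ k = j /\ a = h ->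
    l = i /\ b = 1 \/ l = j /\ b = h ->
    P (z, k, c) -> P (z, l, d) -> a^-1 * b = c^-1 * d -> False.
  move=> kl [[ki ->]|[kj ->]] [[li ->]|[lj ->]] Pc Pd E; subst=> //.
    by apply: nohit; exists z, c, d; rewrite -E invg1 mul1g.
  apply: nohit; exists z, d, c; split=> //.
  by apply: invg_inj; rewrite invgM invgK -E mulg1.
split=> [y k a b|y z k l a b c d kl].
  move=> /cellP[[yx Pa]|[yx Pa]] /cellP[[yx' Pb]|[yx' Pb]] //.
    exact: Pfun Pa Pb.
  by move: Pa Pb => [[-> ->]|[-> ->]] [[E ->]|[E ->]] //; case: ij.
move=> /cellP[[yx Pa]|[yx Pa]] /cellP[[yx' Pb]|[yx' Pb]] //
  /cellP[[zx Pc]|[zx Pc]] /cellP[[zx' Pd]|[zx' Pd]] // E.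
- exact: Pinj kl Pa Pb Pc Pd E.
- by case: (xinj y k l c d a b).
- by case: (xinj z k l a b c d).
- by rewrite yx zx.
Qed.

End Tables.

Lemma orthogonal_family_exists (G : groupType) : infinite_set [set: G] ->
  exists f : G -> G -> G, forall i j, i <> j ->
    bijective (fun x => (f i x)^-1 * f j x).
Proof.
move=> Ginf.
have [p pinj] := injective_pairing Ginf.
(* The requirement [(i, j, g)] asks for the cell [(g, i)] to be filled if
   [i = j], and for [g] to be a value of [x |-> (f i x)^-1 * f j x] otherwise. *)
pose meets (r : G * G * G) (P : set (G * G * G)) := let: (i, j, g) := r in
  if i == j then exists v, P (g, i, v) else
  exists x a b, [/\ P (x, i, a), P (x, j, b) & a^-1 * b = g].
have [||||P [[Pfun Pinj] Pmeets]] :=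
    @transfinite_construction G (G * G * G) (G * G * G)
      (fun r => p (p r.1, r.2)) (@orthogonal_table G G G) meets Ginf.
- by move=> [[i j] g] [[i' j'] g'] /pinj[/pinj[-> ->] ->].
- exact: orthogonal_table_bigcup.
- move=> [[i j] g] P Q PQ /=; case: eqP => _.
    by move=> [v Pv]; exists v; exact: PQ.
  by move=> [x [a [b [Pa Pb E]]]]; exists x, a, b; split=> //; exact: PQ.
- move=> [[i j] g] P Pvalid Psmall /=; case: eqP => [_|ij].
    have [v Pv] := orthogonal_table_fill g i Ginf Pvalid Psmall.
    exists [set (g, i, v)]; split=> //.
    by exists v; right.
  exact: orthogonal_table_hit.
have /choice[f fP] (q : G * G) : exists v, P (q.1, q.2, v).
  by have := Pmeets (q.2, q.2, q.1); rewrite /meets eqxx.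
exists (fun i x => f (x, i)) => i j ij.
have fE x k v : P (x, k, v) -> v = f (x, k).
  by move=> Pv; exact: Pfun Pv (fP (x, k)).
have /choice[g gP] h : exists x, (f (x, i))^-1 * f (x, j) = h.
  have := Pmeets (i, j, h); rewrite /meets; case: eqP => // _.
  by move=> [x [a [b [/fE -> /fE -> E]]]]; exists x.
exists g => // x.
exact: Pinj ij (fP (_, i)) (fP (_, j)) (fP (x, i)) (fP (x, j)) (gP _).
Qed.

(** * Orthomorphisms and their Latin squares *)

Lemma orthogonal_orthomorphisms_exist (G : groupType) :
  infinite_set [set: G] -> exists theta : G -> G -> G,
    (forall i, orthomorphism (theta i)) /\
    forall i j, i <> j -> orthogonal_orthomorphisms (theta i) (theta j).
Proof.
move=> Ginf; have [f fP] := orthogonal_family_exists Ginf.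
(* Pairs tagged with [n 1] index the maps to be kept; two pairs tagged with [n 0] supply the spare
   indices [u] and [v]. *)
have [s [u [v [sinj su sv uv]]]] : exists s : G -> G, exists u v,
    [/\ injective s, forall i, s i <> u, forall i, s i <> v & u <> v].
  have [p pinj] := injective_pairing Ginf.
  have [n ninj _] := card_leTP ((infiniteP _).1 Ginf).
  have n01 : n 0 <> n 1%N by move/ninj.
  exists (fun i => p (n 1%N, i)), (p (n 0, n 0)), (p (n 0, n 1%N)).
  split=> [i j /pinj[]//|i /pinj[/esym]//|i /pinj[/esym]//|/pinj[]//].
have [b fb bf] := fP _ _ uv.
have bbij : bijective b by exists (fun x => (f u x)^-1 * f v x).
have fbP i j : i <> j -> bijective (fun g => (f i (b g))^-1 * f j (b g)).
  by move=> ij; exact: bij_comp (fP _ _ ij) bbij.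
(* As [(f u (b g))^-1 * f v (b g) = g], dividing the new map by [g] on the left replaces [f u] by
   [f v]. *)
exists (fun i g => (f u (b g))^-1 * f (s i) (b g)); split=> [i|i j ij].
  split; first by apply: fbP => /esym/su.
  rewrite (_ : (fun g => _) = (fun g => (f v (b g))^-1 * f (s i) (b g))).
    by apply: fbP => /esym/sv.
  by apply/funext => g; rewrite -{1}[g]bf invgM invgK -mulgA mulVKg.
rewrite /orthogonal_orthomorphisms.
rewrite (_ : (fun g => _) = (fun g => (f (s i) (b g))^-1 * f (s j) (b g))).
  by apply: fbP => /sinj.
by apply/funext => g; rewrite invgM invgK -mulgA mulVKg.
Qed.

(** The two equations for a cell in column [k] force [(theta k)^-1 * phi k = x1^-1 * x2], which
    determines [k]; either equation then gives the row. *)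
Lemma orthogonal_squares_of (G : groupType) (theta phi : G -> G) :
  orthogonal_orthomorphisms theta phi ->
  orthogonal_squares (square_of theta) (square_of phi).
Proof.
move=> [h hK Kh] x1 x2; pose k := h (x1^-1 * x2).
have kE : (theta k)^-1 * phi k = x1^-1 * x2 by exact: Kh.
exists (x1 * (theta k)^-1, k); split.
  by rewrite /square_of /= mulgVK -mulgA kE mulVKg.
move=> [g l] [/= E1 E2]; rewrite /square_of /= in E1 E2.
have kl : k = l.
  by rewrite /k -E1 -E2 invgM -mulgA mulKg hK.
by rewrite kl -E1 mulgK.
Qed.

Lemma latin_square_of (G : groupType) (theta : G -> G) :
  bijective theta -> latin_square (square_of theta).
Proof.
move=> thetabij; split=> [g|h]; rewrite /square_of /=.
  apply: bij_comp thetabij.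
  by exists ( *%g g^-1); [exact: mulKg|exact: mulVKg].
by exists (fun g => g * (theta h)^-1); [exact: mulgK|exact: mulgVK].
Qed.

Theorem theorem5p4 (G : groupType) (G_infinite : infinite_set [set: G]) :
  exists Theta : set (G -> G),
    [/\ Theta #= [set: G],
        (forall theta : G -> G, Theta theta -> orthomorphism theta) &
        mutually (@orthogonal_orthomorphisms G) Theta] /\
    [/\ [set square_of theta | theta in Theta] #= [set: G],
        (forall L : G * G -> G,
          [set square_of theta | theta in Theta] L -> latin_square L) &
        mutually (@orthogonal_squares G)
          [set square_of theta | theta in Theta]].
Proof.
have [theta [theta_ortho theta_orthogonal]] :=
  orthogonal_orthomorphisms_exist G_infinite.
(* If distinct indices gave the same map, orthogonality would make the constant map [1] injective,
   and [G] would be finite. *)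
have theta_inj : injective theta.
  move=> i j ij; apply: contrapT => /theta_orthogonal[h hK _]; apply: G_infinite.
  apply: (sub_finite_set _ (finite_set1 (h 1))) => g _ /=.
  by rewrite -(hK g) ij mulVg.
(* Row [1] of the square is the map itself. *)
have square_inj : injective (@square_of G).
  move=> t t' /funeqP E; apply/funext => h.
  by have := E (1, h); rewrite /square_of /= !mul1g.
have Theta_card : range theta #= [set: G] by apply: inj_card_eq; exact: in2W.
have Theta_orthogonal :
    mutually (@orthogonal_orthomorphisms G) (range theta).
  move=> _ _ [i _ <-] [j _ <-] ij; apply: theta_orthogonal => ij'.
  by apply: ij; rewrite ij'.
exists (range theta); split; split=> //.
- by move=> _ [i _ <-].
- by apply: card_eq_trans Theta_card; apply: inj_card_eq; exact: in2W.
- by move=> _ [_ [i _ <-] <-]; apply: latin_square_of; have [] := theta_ortho i.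
move=> _ _ [t Tt <-] [t' Tt' <-] tt'; apply: orthogonal_squares_of.
by apply: Theta_orthogonal => // E; apply: tt'; rewrite E.
Qed.
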